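(* Let $G$ be an elementary abelian group, i.e. the additive group of a finite field $\mathbb{F}_q$. Then any $(q,k,\lambda)$ difference set in $G$ extends to dimension $q$.
   Context: A $(v,k,\lambda)$ difference set in an additively written group $G$ of order $v$ is a $k$-subset $D\subseteq G$ such that every $g\in G\setminus\{0\}$ can be written as $g=a-b$ with $a,b\in D$ in exactly $\lambda$ ways. An $n$-dimensional $(v,k,\lambda)$ difference set in $G$ is a $k$-subset $E\subseteq G^n$ of $n$-tuples such that for every pair of coordinates $1\le x<y\le n$ the set $\{e_x-e_y\mid e\in E\}$ is a $(v,k,\lambda)$ difference set in $G$. A $(v,k,\lambda)$ difference set $D\subseteq G$ extends to dimension $n$ if there is an $n$-dimensional $(v,k,\lambda)$ difference set $E\subseteq G^n$ and two distinct coordinates $x\ne y$ such that $D=\{e_x-e_y\mid e\in E\}$. *)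

(* Defs.v *)
From HB Require Import structures.
From mathcomp Require Import all_boot all_order all_algebra.

Set Implicit Arguments.
Unset Strict Implicit.
Unset Printing Implicit Defensive.

Import GRing.Theory.
Local Open Scope ring_scope.

Definition difference_set (G : finZmodType) (v k lambda : nat) (D : {set G}) :
    Prop :=
  [/\ #|G| = v, #|D| = k &
      forall g : G, g != 0 ->
        #|[set ab in setX D D | ab.1 - ab.2 == g]| = lambda].

Definition coord_diff (G : finZmodType) (n : nat) (E : {set n.-tuple G})
    (x y : 'I_n) : {set G} :=
  [set tnth e x - tnth e y | e in E].

(* Coordinates are numbered from 0 to n - 1. *)
Definition dim_difference_set (G : finZmodType) (n v k lambda : nat)
    (E : {set n.-tuple G}) : Prop :=
  #|E| = k /\
  forall x y : 'I_n, (x < y)%N -> difference_set v k lambda (coord_diff E x y).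

Definition extends_to_dim (G : finZmodType) (n v k lambda : nat) (D : {set G}) :
    Prop :=
  exists (E : {set n.-tuple G}) (x y : 'I_n),
    [/\ dim_difference_set v k lambda E, x != y & D = coord_diff E x y].

(* Main.v *)
Require Import Defs.
From HB Require Import structures.
From mathcomp Require Import all_boot all_order all_algebra.

(** Enumerate the field as a_0, ..., a_(q-1) and take
    E = { (a_0 d, ..., a_(q-1) d) | d in D }.  The differences of the coordinates
    x and y form the dilate (a_x - a_y) D, which is again a difference set because
    a_x - a_y is invertible; for a_x = 1 and a_y = 0 it is D itself. *)

Import GRing.Theory.
Local Open Scope ring_scope.

(** Multiplying both entries by [c] maps the pairs in [D] with difference [c^-1 * g] bijectively
    onto the pairs in the dilate with difference [g]. *)
Lemma difference_set_dilate {F : finFieldType} {v k lambda : nat}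
    {D : {set F}} {c : F} :
  c != 0 -> difference_set v k lambda D ->
  difference_set v k lambda [set c * d | d in D].
Proof.
move=> c0 [cardF cardD countD].
have injc : injective ( *%R c) by exact: mulfI.
split=> //; first by rewrite card_imset.
move=> g g0.
have cg0 : c^-1 * g != 0 by rewrite mulf_neq0 ?invr_eq0.
rewrite -(countD _ cg0).
pose h (ab : F * F) := (c * ab.1, c * ab.2).
have injh : injective h by move=> [a b] [a' b'] [/injc -> /injc ->].
rewrite -[RHS](card_imset _ injh); apply: eq_card => -[a b].
rewrite !inE /=; apply/andP/imsetP.
- case=> /andP[/imsetP[a' Da ->] /imsetP[b' Db ->]] /eqP <-.
  by exists (a', b'); rewrite // !inE /= Da Db -mulrBr mulKf /=.
- case=> -[a' b']; rewrite !inE /= => /andP[/andP[Da Db] /eqP E] [-> ->].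
  by rewrite !imset_f // -mulrBr E mulVKf.
Qed.

Theorem theorem4p4 (F : finFieldType) (q k lambda : nat) (hq : #|F| = q)
    (D : {set F}) (hD : difference_set q k lambda D) :
  extends_to_dim q q k lambda D.
Proof.
subst q.
pose f (d : F) : #|F|.-tuple F := [tuple enum_val i * d | i < #|F|].
have fE d i : tnth (f d) i = enum_val i * d by rewrite tnth_mktuple.
have diffE x y : coord_diff (f @: D) x y
    = [set (enum_val x - enum_val y) * d | d in D].
  rewrite /coord_diff -imset_comp; apply: eq_imset => d /=.
  by rewrite !fE mulrBl.
exists (f @: D), (enum_rank (1 : F)), (enum_rank (0 : F)); split.
- split.
    rewrite card_imset; first by case: hD.
    (* The coordinate of [f d] at the rank of 1 is [d] itself, so [f] is injective. *)
    move=> d d' /(congr1 (fun t => tnth t (enum_rank (1 : F)))).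
    by rewrite !fE enum_rankK !mul1r.
  move=> x y xy; rewrite diffE; apply: difference_set_dilate => //.
  (* The dilation factor is nonzero because distinct indices enumerate distinct field elements. *)
  rewrite subr_eq0 (inj_eq enum_val_inj).
  by apply: contraTneq xy => ->; rewrite ltnn.
- by rewrite (inj_eq enum_rank_inj) oner_eq0.
- rewrite diffE !enum_rankK subr0 -[LHS]imset_id.
  by apply: eq_imset => d; rewrite mul1r.
Qed.
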